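(* Let $\theta\in(0,1)$, let $l:(0,1)\times\mathbb{N}\to(0,\infty)$ be a function such that $l(\theta,n)$ is slowly varying as $n\to\infty$, and let $(S_n)_{n\ge1}$ be a sequence of random variables (statistics) such that, as $n\to\infty$, $$\mathbf{E} S_n=n^{\theta}\, l(\theta,n)+o\bigl(\sqrt{\mathbf{E} S_n}\bigr),\qquad \frac{\mathbf{Var}\, S_n}{\mathbf{E} S_n}\to\sigma^2,\qquad \frac{S_n}{\mathbf{E} S_n}\xrightarrow{a.s.}1,\qquad \frac{S_n-\mathbf{E} S_n}{\sqrt{\mathbf{Var}\, S_n}}\Rightarrow \mathbf{N}_{0,1}.$$ Let $\theta_n^*\in(0,1)$ be a solution of the equation $S_n=n^{\theta_n^*}\, l(\theta_n^*,n)$, and suppose that $$\widetilde{l}_n:=\frac{\ln l(\theta_n^*,n)-\ln l(\theta,n)}{(\theta_n^*-\theta)\ln n}\xrightarrow{p}0 \quad\text{as } n\to\infty.$$ Then, as $n\to\infty$, $$\ln n\,\sqrt{S_n}\,(\theta_n^*-\theta)\Rightarrow \mathbf{N}_{0,\sigma^2}.$$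
   Context: $\Rightarrow \mathbf{N}_{0,\sigma^2}$ denotes weak convergence (convergence in distribution) to the normal law with mean $0$ and variance $\sigma^2$. All convergences are as $n\to\infty$; $\xrightarrow{p}$ and $\xrightarrow{a.s.}$ denote convergence in probability and almost surely. The random variable $\theta_n^*$ is an estimator of the unknown parameter $\theta$. The quotient $\widetilde l_n$ is read as $0$ on the event $\theta_n^*=\theta$. *)

(* Defs.v *)
From HB Require Import structures.
From mathcomp Require Import all_boot all_order all_algebra.
From mathcomp Require Import all_classical all_reals all_analysis.

Set Implicit Arguments.
Unset Strict Implicit.
Unset Printing Implicit Defensive.

Import Order.TTheory GRing.Theory Num.Theory.
Import numFieldNormedType.Exports.

Local Open Scope classical_set_scope.
Local Open Scope ring_scope.

(* Slow variation of a sequence in the sense of Bojanic, Galambos and Seneta: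
   L (floor (c * n)) / L n --> 1 for every real c > 0, not only for integral c.
   When L is positive this is equivalent to slow variation at infinity of the
   function x |-> L (floor x). *)
Definition slowly_varying (R : realType) (L : nat -> R) : Prop :=
  forall c : R, 0 < c ->
    L (Num.truncn (c * n%:R)) / L n @[n --> \oo] --> (1 : R).

(* Normal law with mean m and variance s ^+ 2. The case s = 0 is singled out
   because normal_prob m 0 is the uniform law on [0, 1], not the point mass. *)
Definition normal_law (R : realType) (m s : R) :
    probability (measurableTypeR R) R :=
  if s == 0 then [the probability _ _ of \d_(m : measurableTypeR R)]
  else [the probability _ _ of normal_prob m s].

(* The functions X n are meant to be measurable: 'E_P[f \o X n] is then the
   integral of f against the law of X n. *)
Definition cvg_in_distribution d (T : measurableType d) (R : realType)
    (P : probability T R) (X : nat -> T -> R)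
    (mu : probability (measurableTypeR R) R) : Prop :=
  forall f : R -> R, continuous f -> bounded_fun f ->
    ('E_P[f \o X n])%E @[n --> \oo] --> (\int[mu]_x (f x)%:E)%E.

Definition cvg_in_probability d (T : measurableType d) (R : realType)
    (P : probability T R) (X : nat -> T -> R) (c : R) : Prop :=
  forall e : R, 0 < e ->
    P [set w | e <= `|X n w - c|] @[n --> \oo] --> 0%E.

(* Since x / 0 = 0, the quotient is 0 when t = theta. *)
Definition log_quotient (R : realType) (l : R -> nat -> R) (theta t : R)
    (n : nat) : R :=
  (ln (l t n) - ln (l theta n)) / ((t - theta) * ln n%:R).

(* Main.v *)
(* With a n = n^theta l(theta, n), taking logarithms in the equation defining
   theta_n^* gives
     (theta_n^* - theta) ln n (1 + l~_n) = ln (S_n / E S_n) + ln (E S_n / a n).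
   After multiplication by sqrt S_n, the first term on the right is equivalent to
   (S_n - E S_n) / sqrt (E S_n) ==> N(0, sigma^2), because ln x ~ x - 1 at 1,
   and the second one tends to 0, because E S_n - a n = o(sqrt (E S_n)) and E S_n
   stays away from 0 (slow variation yields a (floor (n / 2)) <= a n for large n,
   whence a lower bound for a by halving). Slutsky's theorem concludes. *)

Require Import Defs.
From HB Require Import structures.
From mathcomp Require Import all_boot all_order all_algebra.
From mathcomp Require Import all_classical all_reals all_analysis.
From mathcomp Require Import measurable_realfun ring lra.

Set Implicit Arguments.
Unset Strict Implicit.
Unset Printing Implicit Defensive.

Import Order.TTheory GRing.Theory Num.Theory.
Import numFieldNormedType.Exports.

Local Open Scope classical_set_scope.
Local Open Scope ring_scope.

(** * Lower bounds from slow variation, and estimates for the logarithm near 1 *)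

Section real_sequences.
Context (R : realType).

Lemma pos_lower_bound_lt (a : nat -> R) N : (forall n, (0 < n)%N -> 0 < a n) ->
  exists2 c, 0 < c & forall n, (0 < n < N)%N -> c <= a n.
Proof.
move=> a0; elim: N => [|N [c c0 ca]]; first by exists 1 => // n /andP[].
have [->|N0] := posnP N.
  by exists c => // n /andP[n0 n1]; move: n0; rewrite ltnNge -ltnS n1.
exists (Num.min c (a N)); first by rewrite lt_min c0 a0.
move=> n /andP[n0]; rewrite ltnS leq_eqVlt => /predU1P[->|nN].
  by rewrite ge_min lexx orbT.
by rewrite ge_min ca// n0.
Qed.

(** The factor [2^t] gained by [n^t] between the index [n / 2] and [n] eventually outweighs the
    variation of [L], so [a] does not grow under halving. Repeated halving leads to finitely many
    indices, where a positive minimum exists. *)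
Lemma slowly_varying_lower_bound (t : R) (L : nat -> R) : 0 < t ->
  (forall n, (0 < n)%N -> 0 < L n) -> slowly_varying L ->
  exists2 c, 0 < c & forall n, (0 < n)%N -> c <= n%:R `^ t * L n.
Proof.
move=> t0 L0 svL; pose a n := n%:R `^ t * L n.
have a0 n : (0 < n)%N -> 0 < a n.
  by move=> n0; rewrite mulr_gt0 ?L0// powR_gt0// ltr0n.
pose h n := Num.truncn (2^-1 * n%:R : R).
(* The ratio tends to 1, and [1 < 2^t] because [t] is positive. *)
have [N _ NL] : \forall n \near \oo, L (h n) / L n < 2 `^ t.
  apply: (cvgr_lt 1); first exact: svL.
  rewrite -[ltLHS](_ : 1 `^ t = 1); last by rewrite powR1.
  by apply: gt0_ltr_powR; rewrite ?nnegrE ?ltr1n.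
(* From 2 on, halving decreases the index strictly and keeps it positive: the descent stops before
   index 0, where [L] need not be positive. *)
have hn n : (2 <= n)%N -> (0 < h n < n)%N.
  move=> n2; have n2' : 2 <= n%:R :> R by rewrite ler_nat.
  rewrite /h truncn_gt0 truncn_lt_nat; last by rewrite mulr_ge0.
  by apply/andP; split; lra.
have ah n : (N <= n)%N -> (2 <= n)%N -> a (h n) <= a n.
  move=> /NL /= Ln n2; have /andP[h0 _] := hn _ n2.
  have n0 : (0 < n)%N by apply: leq_trans n2.
  rewrite ltr_pdivrMr ?L0// in Ln.
  rewrite /a; have hh : (h n)%:R `^ t <= (2^-1 * n%:R) `^ t.
    apply: ge0_ler_powR; rewrite ?nnegrE ?mulr_ge0//; first exact: ltW.
    by rewrite /h truncn_le mulr_ge0.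
  rewrite (le_trans (ler_wpM2r _ hh)) ?(ltW (L0 _ _))//.
  rewrite powRM// (le_trans (ler_wpM2l _ (ltW Ln))) ?mulr_ge0 ?powR_ge0//.
  by rewrite mulrACA -powRM// mulVf// powR1 mul1r.
have [c c0 ca] := @pos_lower_bound_lt a (maxn N 2) a0.
exists c => // n; rewrite -/(a n); elim/ltn_ind: n => n IH n0.
have [nN|nN] := ltnP n (maxn N 2); first by apply: ca; rewrite n0.
move: nN; rewrite geq_max => /andP[nN n2].
have /andP[h0 hltn] := hn _ n2.
by apply: le_trans (ah _ nN n2); exact: IH.
Qed.

(** The lower bound is the upper bound taken at [x^-1]. *)
Lemma ln_bounds (x : R) : 0 < x -> 1 - x^-1 <= ln x <= x - 1.
Proof.
move=> x0; apply/andP; split.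
  rewrite -[ln x]opprK -lnV ?posrE// lerNr opprB.
  have := @le_ln1Dx R (x^-1 - 1); rewrite [1 + _]addrC subrK; apply.
  by rewrite ltrBrDr addNr invr_gt0.
by have := @le_ln1Dx R (x - 1); rewrite [1 + _]addrC subrK; apply; lra.
Qed.

(** The constant 2 is the bound for [x^-1] on the half-line from 1/2. *)
Lemma ler_norm_ln (x : R) : 2^-1 <= x -> `|ln x| <= 2 * `|x - 1|.
Proof.
move=> x2; have x0 : 0 < x by lra.
have /andP[lo up] := ln_bounds x0.
have xV : x^-1 - 1 <= 2 * `|x - 1|.
  have -> : x^-1 - 1 = x^-1 * (1 - x) by rewrite mulrBr mulr1 mulVf ?gt_eqF.
  rewrite (le_trans (ler_norm _))// normrM distrC ler_wpM2r//.
  by rewrite gtr0_norm ?invr_gt0// invf_ple// posrE.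
rewrite ler_norml; have := ler_norm (x - 1); have := normr_ge0 (x - 1); lra.
Qed.

(** The quantity is of order [|m - a| / sqrt m], which is o(1). The lower bound on [a] keeps [m]
    away from 0, so that [a / m] does tend to 1. *)
Lemma log_ratio_cvg0 (m a : nat -> R) (c : R) : 0 < c ->
  (\forall n \near \oo, c <= a n) ->
  m = a +o_\oo (fun n => Num.sqrt (m n)) ->
  (\forall n \near \oo, 0 < m n) /\
  Num.sqrt (m n) * ln (m n / a n) @[n --> \oo] --> (0 : R).
Proof.
move=> c0 ca /eqaddoP ma.
(* If [m n <= 0], its square root is 0 by convention, and the little-o bound forces
   [m n = a n >= c], a contradiction. *)
have mpos : \forall n \near \oo, 0 < m n.
  have := ma 1 ltr01; apply: filterS2 ca => n can; rewrite mul1r /= => man.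
  rewrite ltNge; apply/negP => mn; move: man; rewrite ler0_sqrtr// normr0.
  by rewrite normr_le0 subr_eq0 => /eqP; lra.
split => //.
(* If [t = sqrt (m n)] were below [t0], then [t <= 1/2] and [a n <= t^2 + t <= 3 t / 2 < 2 t0 <= c],
   a contradiction. *)
pose t0 := Num.min 1 c / 2.
have t00 : 0 < t0 by rewrite divr_gt0// lt_min ltr01.
have tlow : \forall n \near \oo, t0 <= Num.sqrt (m n).
  have := ma 1 ltr01; apply: filterS3 ca mpos => n can mn.
  rewrite mul1r /= (ger0_norm (sqrtr_ge0 _)) ler_norml => /andP[man _].
  rewrite leNgt; apply/negP => tlt.
  have t1 : t0 <= 2^-1 by rewrite /t0 ler_pdivrMr// mulVf// ge_min lexx.
  have t2 : 2 * t0 <= c by rewrite /t0 mulrC divfK// ge_min lexx orbT.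
  have := sqr_sqrtr (ltW mn); have := sqrtr_ge0 (m n).
  move: tlt man; rewrite /=; set t := Num.sqrt _ => tlt man tge tsq.
  have tt : t * t <= t * 2^-1 by rewrite ler_wpM2l//; lra.
  have {}man : - t <= m n - a n by exact: man.
  by rewrite expr2 in tsq; lra.
apply/cvgrPdist_le => e e0.
(* The second bound gives [a n / m n >= 1/2], as [ler_norm_ln] requires; the first makes the final
   estimate [2 e'] at most [e]. *)
pose e' := Num.min (e / 4) (t0 / 2).
have e'0 : 0 < e' by rewrite lt_min (divr_gt0 e0)// (divr_gt0 t00).
near=> n.
have man : `|m n - a n| <= e' * Num.sqrt (m n).
  rewrite -[X in _ * X]ger0_norm ?sqrtr_ge0//.
  by near: n; exact: ma.
have mn : 0 < m n by near: n.
have an : 0 < a n by apply: lt_le_trans c0 _; near: n.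
have tn : t0 <= Num.sqrt (m n) by near: n.
(* The ratio is inverted, at the cost of a sign, so that the error is measured relative to [m n]
   rather than [a n]. *)
rewrite sub0r normrN -[m n / _]invrK lnV ?posrE ?invr_gt0 ?divr_gt0//.
rewrite normrM normrN invf_div.
set t := Num.sqrt (m n) in man tn *.
have tt : t ^+ 2 = m n by rewrite sqr_sqrtr// ltW.
have t1 : 0 < t by exact: lt_le_trans tn.
have d : `|a n / m n - 1| <= e' / t.
  have -> : a n / m n - 1 = - ((m n - a n) / m n) by field; rewrite gt_eqF.
  rewrite normrN normrM (gtr0_norm (_ : 0 < (m n)^-1)) ?invr_gt0//.
  by rewrite ler_pdivrMr// -[in leRHS]tt (le_trans man)//
    expr2 mulrA divfK ?gt_eqF.
have e1 : e' <= e / 4 by rewrite /e' ge_min lexx.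
have e2 : e' <= t0 / 2 by rewrite /e' ge_min lexx orbT.
have et : e' / t <= 2^-1 by rewrite ler_pdivrMr//; lra.
have := d; rewrite ler_norml => /andP[d1 d2].
rewrite (gtr0_norm t1) (le_trans (ler_wpM2l (ltW t1) (ler_norm_ln _)))//.
  by lra.
rewrite (le_trans (ler_wpM2l (ltW t1) (ler_wpM2l _ d)))//.
have -> : t * (2 * (e' / t)) = 2 * e' by field; rewrite gt_eqF.
by lra.
Unshelve. all: by end_near. Qed.

(* Since 0 / 0 = 0, the boolean term is what makes the value at 1 equal to 1. *)
Definition ln_slope (x : R) : R := ln x / (x - 1) + (x == 1)%:R.

Lemma ln_slopeE (x : R) : ln x = (x - 1) * ln_slope x.
Proof.
rewrite /ln_slope; have [->|x1] := eqVneq x 1; first by rewrite ln1 subrr mul0r.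
by rewrite addr0 mulrC divfK// subr_eq0.
Qed.

(** By [ln_bounds] the slope lies between [x^-1] and 1. The neighbourhood of 1 is not punctured, so
    the limit composes with ratios that may equal 1. *)
Lemma cvg_ln_slope : ln_slope x @[x --> (1 : R)] --> (1 : R).
Proof.
have bnd (x : R) : 0 < x -> `|1 - ln_slope x| <= `|1 - x^-1|.
  move=> x0; have := ln_slopeE x.
  have [->|x1] := eqVneq x 1.
    by rewrite /ln_slope ln1 mul0r add0r eqxx invr1 subrr normr0.
  move=> lnE; have /andP[] := ln_bounds x0; rewrite {}lnE.
  have {1}-> : 1 - x^-1 = (x - 1) * x^-1.
    by rewrite mulrBl divff ?gt_eqF// mul1r.
  have [x1'|x1'|x1'] := ltgtP x 1; last by move/eqP: x1.
  - have x0' : x - 1 < 0 by rewrite subr_lt0.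
    rewrite ler_nM2l// => s1.
    rewrite -[leRHS]mulr1 ler_nM2l// => s2.
    by rewrite !ler0_norm ?subr_le0//; lra.
  - have x0' : 0 < x - 1 by rewrite subr_gt0.
    rewrite ler_pM2l// => s1.
    rewrite -[leRHS]mulr1 ler_pM2l// => s2.
    by rewrite !ger0_norm ?subr_ge0//; lra.
apply/cvgrPdist_le => e e0.
have : (x : R)^-1 @[x --> (1 : R)] --> (1 : R)^-1.
  by apply: cvgV; [exact: oner_neq0|exact: cvg_id].
rewrite invr1 => /cvgrPdist_le/(_ _ e0).
apply: filterS2 (lt_nbhsr (@ltr01 R)) => x x0; apply: le_trans.
exact: bnd.
Qed.

End real_sequences.

(** * Measurability of inverses, square roots and tail events *)

Section measurable_composition.
Context d (T : measurableType d) (R : realType).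

(** The power function of exponent -1 is measurable and agrees with the inverse on nonnegative
    reals, 0 included; oddness of the inverse settles the negative ones. *)
Lemma measurable_inv_comp (f : T -> R) :
  measurable_fun setT f -> measurable_fun setT (fun w => (f w)^-1).
Proof.
move=> mf.
have -> : (fun w => (f w)^-1) = (fun w => if 0 <= f w then (f w) `^ (-1)
     else - ((- f w) `^ (-1))).
  apply/funext => w; case: ifPn => [f0|]; first by rewrite powR_inv1.
  by rewrite -ltNge => f0; rewrite powR_inv1 ?oppr_ge0 ?ltW// invrN opprK.
have mp (g : T -> R) : measurable_fun setT g ->
    measurable_fun setT (fun w => g w `^ (-1)).
  by move=> mg; exact: (measurableT_comp (measurable_powR (-1)) mg).
apply: measurable_fun_ifT.
- exact: measurable_fun_ler.
- exact: mp.
- by apply: measurable_funN; apply: mp; exact: measurable_funN.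
Qed.

Lemma measurable_sqrt_comp (f : T -> R) :
  measurable_fun setT f -> measurable_fun setT (fun w => Num.sqrt (f w)).
Proof.
move=> mf; apply: (measurableT_comp _ mf).
by apply: continuous_measurable_fun; exact: sqrt_continuous.
Qed.

Lemma measurable_ge_norm (X : T -> R) (r : R) : measurable_fun setT X ->
  measurable [set w | r <= `|X w|].
Proof.
move=> mX; have -> : [set w | r <= `|X w|] =
    setT `&` (fun w => `|X w|) @^-1` `[r, +oo[.
  by rewrite setTI; apply/seteqP; split=> w /=; rewrite in_itv/= andbT.
have mnX : measurable_fun setT (fun w => `|X w|) by exact: measurableT_comp.
by apply: mnX => //; exact: measurable_itv.
Qed.

End measurable_composition.

(** * Convergence in probability as convergence along a filter *)

Lemma cvge_near_lt (R : realType) (I : Type) (F : set_system I) {FF : Filter F}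
    (u : I -> \bar R) (l r : R) : u x @[x --> F] --> l%:E -> l < r ->
  \forall x \near F, (u x < r%:E)%E.
Proof.
move=> /fine_cvgP[ufin ul] lr; near=> x.
rewrite -[u x]fineK; last by near: x.
by rewrite lte_fin; near: x; exact: (cvgr_lt l).
Unshelve. all: by end_near. Qed.

Section cvg_probability.
Context d (T : measurableType d) (R : realType) (P : probability T R).

(* A filter on pairs (n, w) such that limits along it are limits in probability,
   so that the algebra of limits applies to them. The exceptional set A, rather
   than Q, is measurable, so convergence along it presupposes no measurability. *)
Definition nbhs_proba : set_system (nat * T) := fun Q => forall e : R, 0 < e ->
  \forall n \near \oo, exists A, [/\ measurable A, (P A <= e%:E)%E &
    forall w, ~ A w -> Q (n, w)].

#[global] Instance nbhs_proba_filter : Filter nbhs_proba.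
Proof.
split.
- by move=> e e0; near=> n; exists set0; split; rewrite ?measure0 ?lee_fin ?ltW.
- move=> Q1 Q2 FQ1 FQ2 e e0.
  have e20 : 0 < e / 2 by rewrite divr_gt0.
  near=> n.
  have [A [mA PA AQ]] : exists A, [/\ measurable A, (P A <= (e / 2)%:E)%E &
      forall w, ~ A w -> Q1 (n, w)] by near: n; exact: FQ1.
  have [B [mB PB BQ]] : exists A, [/\ measurable A, (P A <= (e / 2)%:E)%E &
      forall w, ~ A w -> Q2 (n, w)] by near: n; exact: FQ2.
  exists (A `|` B); split; first exact: measurableU.
    rewrite (le_trans (measureU2 _ _ _))// (splitr e) EFinD.
    exact: leeD.
  by move=> w /not_orP[nA nB]; split; [exact: AQ|exact: BQ].
- move=> Q1 Q2 Q12 FQ1 e e0; near=> n.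
  have [A [mA PA AQ]] : exists A, [/\ measurable A, (P A <= e%:E)%E &
      forall w, ~ A w -> Q1 (n, w)] by near: n; exact: FQ1.
  by exists A; split => // w /AQ/Q12.
Unshelve. all: by end_near. Qed.

(** With empty exceptional sets, this carries deterministic limits over to [nbhs_proba]. *)
Lemma nbhs_proba_fst : fst @ nbhs_proba --> \oo.
Proof.
move=> Q QF e e0; near=> n; exists set0; split=> //.
- by rewrite measure0 lee_fin ltW.
- by move=> w _ /=; near: n.
Unshelve. all: by end_near. Qed.

Lemma cvg_in_probability_nbhs (X : nat -> T -> R) c :
  (forall n, measurable_fun setT (X n)) ->
  cvg_in_probability P X c -> X z.1 z.2 @[z --> nbhs_proba] --> c.
Proof.
move=> mX Xc; apply/cvgrPdist_lt => e e0 r r0 /=.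
have mE n : measurable [set w | e <= `|X n w - c|].
  exact: (measurable_ge_norm _ (measurable_funB _ _)).
have : \forall n \near \oo, (P [set w | (e <= `|X n w - c|)%R] < r%:E)%E.
  exact: cvge_near_lt (Xc e e0) r0.
apply: filterS => n Pn; exists [set w | e <= `|X n w - c|]; split => //.
  exact: ltW.
by move=> w /= /negP; rewrite -ltNge distrC.
Qed.

(** Egorov's theorem: convergence is uniform off a measurable set of small probability, and this one
    set serves for all large [n]. *)
Lemma cvg_ae_nbhs (X : nat -> T -> R) (c : R) :
  (forall n, measurable_fun setT (X n)) ->
  {ae P, forall w, X n w @[n --> \oo] --> c} ->
  X z.1 z.2 @[z --> nbhs_proba] --> c.
Proof.
move=> mX Xc; apply/cvgrPdist_lt => e e0 r r0 /=.
have [B [mB PB XB]] : exists B, [/\ measurable B, (P B < r%:E)%E &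
    {uniform setT `\` B, X @ \oo --> cst c}].
  apply: ae_pointwise_almost_uniform => //.
  - by rewrite (le_lt_trans (probability_le1 _ _))// ltry.
  - by apply: filterS Xc => w Xw _.
have : \forall n \near \oo, forall w, ~ B w -> `|c - X n w| < e.
  have := XB [set h | forall w, ~ B w -> `|c - h w| < e].
  apply; apply/uniform_nbhs; exists [set p | `|p.1 - p.2| < e]; split.
    exact: (@entourage_ball _ _ (PosNum e0)).
  by move=> h /= hc w Bw; apply: hc; split.
apply: filterS => n Pn; exists B; split => //; exact: ltW.
Qed.

Lemma bounded_integrable (h : T -> R) K :
  measurable_fun setT h -> (forall w, `|h w| <= K) ->
  P.-integrable setT (EFin \o h).
Proof.
move=> mh hK; apply: measurable_bounded_integrable => //.
  by rewrite (le_lt_trans (probability_le1 _ _))// ltry.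
exists K; split; first exact: num_real.
by move=> M KM w _ /=; rewrite (le_trans (hK w))// ltW.
Qed.

(** Bounded convergence in probability: the integral is split between a small exceptional set, where
    [h n] is bounded, and its complement, where [h n] is small. *)
Lemma cvg_expectation_nbhs (h : nat -> T -> R) K :
  (forall n, measurable_fun setT (h n)) ->
  (forall n w, `|h n w| <= K) ->
  h z.1 z.2 @[z --> nbhs_proba] --> (0 : R) ->
  (\int[P]_w (h n w)%:E)%E @[n --> \oo] --> 0%E.
Proof.
move=> mh hK h0.
have ih n : P.-integrable setT (EFin \o h n) by exact: bounded_integrable (hK n).
apply/fine_cvgP; split.
  by near=> n; apply: integrable_fin_num => //; exact: ih.
apply/cvgrPdist_le => e e0.
have e2 : 0 < e / 2 by rewrite divr_gt0.
pose K' := `|K| + 1.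
have K1 : 0 < K' by rewrite ltr_wpDl.
move/cvgrPdist_lt : h0 => /(_ _ e2) /(_ _ (divr_gt0 e2 K1)).
apply: filterS => n [A [mA PA Ah]].
rewrite sub0r normrN /= -fine_abse; last exact: integrable_fin_num (ih n).
rewrite -lee_fin fineK; last first.
  by rewrite abse_fin_num; exact: integrable_fin_num (ih n).
rewrite (le_trans (le_abse_integral _ _ _))//.
  exact: measurable_int (ih n).
(* [g] dominates [|h n|], and its integral is at most [e] because [P A <= e / 2 / K']. *)
pose g w := e / 2 + K' * \1_A w.
have mg : measurable_fun setT g.
  by apply: measurable_funD => //; apply: measurable_funM => //.
apply: (@le_trans _ _ (\int[P]_w (g w)%:E)%E).
  apply: ge0_le_integral => //.
  - by apply: measurableT_comp => //; exact: measurable_int (ih n).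
  - exact/measurable_EFinP.
  move=> w _; rewrite /= lee_fin /g indicE.
  have [/set_mem wA|/negP nwA] := boolP (w \in A).
    rewrite mulr1 (le_trans (hK n w))// /K'.
    by have := ler_norm K; lra.
  rewrite mulr0 addr0; have /Ah : ~ A w by move=> /mem_set.
  by rewrite /= sub0r normrN => /ltW.
rewrite /g; under eq_integral do rewrite EFinD EFinM.
rewrite integralD//=; last 2 first.
- exact: (@bounded_integrable (cst (e / 2)) `|e / 2|).
- apply: (@bounded_integrable (fun w => K' * \1_A w) K').
    by apply: measurable_funM => //.
  move=> w; rewrite normrM (gtr0_norm K1) ler_piMr ?(ltW K1)//.
  by rewrite indicE; case: (_ \in _); rewrite ?normr1 ?normr0.
rewrite integral_cst//= probability_setT mule1.
have -> : (\int[P]_w (K' * \1_A w)%:E = K'%:E * P A)%E.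
  under eq_integral do rewrite EFinM.
  rewrite integralZl//; first by rewrite integral_indic// setIT.
  apply: (@bounded_integrable \1_A 1) => //.
  by move=> w; rewrite indicE; case: (_ \in _); rewrite ?normr1 ?normr0.
rewrite [leRHS](_ : _ = (e / 2)%:E + (e / 2)%:E)%E.
  rewrite leeD2l// (le_trans (lee_wpmul2l _ PA)) ?lee_fin ?(ltW K1)//.
  by rewrite mulrC divfK ?gt_eqF.
by rewrite -EFinD -splitr.
Unshelve. all: by end_near. Qed.

End cvg_probability.

(** * Tightness, weak convergence and Slutsky's theorem *)

Lemma integral_indic_setT d (T : measurableType d) (R : realType)
    (mu : {measure set T -> \bar R}) (A : set T) : measurable A ->
  (\int[mu]_w (\1_A w)%:E = mu A)%E.
Proof. by move=> mA; rewrite integral_indic// setIT. Qed.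

(** Continuity from above: the tails decrease to the empty set by the Archimedean property. *)
Lemma probability_tail (R : realType) (mu : probability (measurableTypeR R) R)
    (e : R) : 0 < e ->
  exists M : R, (mu [set x : measurableTypeR R | (M <= `|x|)%R] < e%:E)%E.
Proof.
move=> e0; pose F n : set (measurableTypeR R) := [set x : R | n%:R <= `|x|].
have mF n : measurable (F n).
  exact: (@measurable_ge_norm _ (measurableTypeR R) R (fun x => x)).
have F0 : \bigcap_n F n = set0.
  rewrite -subset0 => x /(_ (Num.bound `|x|) I).
  by rewrite /F /= leNgt => /negP; apply; exact: archi_boundP.
have : (mu \o F) x @[x --> \oo] --> mu (\bigcap_n F n).
  apply: nonincreasing_cvg_mu => //.
  - by rewrite (le_lt_trans (probability_le1 _ _))// ltry.
  - exact: bigcapT_measurable.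
  - move=> m n mn; apply/subsetPset => x /=; apply: le_trans.
    by rewrite ler_nat.
rewrite F0 measure0 => /cvge_near_lt /(_ e0) [N _ /(_ N (leqnn _))] /= muN.
by exists N%:R.
Qed.

Section weak_convergence.
Context d (T : measurableType d) (R : realType) (P : probability T R).

Lemma cvg_in_distribution_tight (X : nat -> T -> R) mu :
  (forall n, measurable_fun setT (X n)) ->
  cvg_in_distribution P X mu ->
  forall e : R, 0 < e -> exists M : R,
    \forall n \near \oo, (P [set w | (M <= `|X n w|)%R] <= e%:E)%E.
Proof.
move=> mX Xmu e e0.
have [M muM] := probability_tail mu e0.
(* A continuous ramp, 0 for [|x| <= M] and 1 for [|x| >= M + 1]. It lies between the indicators of
   the tails at [M + 1] and at [M], hence the bound [M + 1] below. *)
pose phi : R -> R := (cst 1 \min (cst 0 \max (fun x : R => `|x| - M))).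
have phi_c : continuous phi.
  move=> x; apply: continuous_min; first exact: cvg_cst.
  apply: continuous_max; first exact: cvg_cst.
  apply: cvgB; last exact: cvg_cst.
  exact: norm_continuous.
have phi_m : measurable_fun setT (phi : measurableTypeR R -> R).
  exact: continuous_measurable_fun.
have phi0 x : 0 <= phi x by rewrite /phi /= le_min ler01 le_max lexx.
have phi1 x : phi x <= 1 by rewrite /phi /= ge_min lexx.
have phiN x : `|phi x| <= 1 by rewrite ger0_norm.
have phi_b : bounded_fun phi.
  exists 1; split; first exact: num_real.
  by move=> K K1 x _ /=; rewrite (le_trans (phiN x))// ltW.
have mtail := @measurable_ge_norm _ (measurableTypeR R) R id M (@measurable_id _ _ _).
have phimu : (\int[mu]_x (phi x)%:E < e%:E)%E.
  apply: le_lt_trans muM.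
  rewrite -[leRHS]integral_indic_setT; last exact: mtail.
  apply: ge0_le_integral => //.
  - by move=> x _; rewrite lee_fin.
  - exact/measurable_EFinP.
  - by apply/measurable_EFinP; exact: measurable_indic.
  move=> x _; rewrite lee_fin indicE.
  have [//|/negP] := boolP (x \in _).
  rewrite inE /= => /negP; rewrite -ltNge => xM.
  by rewrite /phi /= (max_idPl _) ?ge_min ?lexx ?orbT// subr_le0 ltW.
exists (M + 1).
have := Xmu phi phi_c phi_b.
have imu : (\int[mu]_x (phi x)%:E)%E \is a fin_num.
  by apply: integrable_fin_num => //; exact: (bounded_integrable mu phi_m phiN).
rewrite -[X in _ --> X]fineK// => /cvge_near_lt Xphi.
have {}Xphi : \forall n \near \oo, ('E_P[phi \o X n] < e%:E)%E.
  by apply: Xphi; rewrite -lte_fin fineK.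
apply: filterS Xphi => n /ltW; apply: le_trans.
rewrite unlock -integral_indic_setT; last exact: measurable_ge_norm.
have mphiX : measurable_fun setT (phi \o X n) by exact: measurableT_comp.
apply: ge0_le_integral => //.
- by apply/measurable_EFinP/measurable_indic; exact: measurable_ge_norm.
- exact/measurable_EFinP.
move=> w _; rewrite lee_fin indicE.
have [|_] := boolP (w \in [set w | M + 1 <= `|X n w|]); last exact: phi0.
rewrite inE /= => XM; rewrite /phi /= le_min lexx/= le_max; apply/orP; right.
by rewrite lerBrDr addrC.
Qed.
(** By tightness [X] is bounded by a constant up to small probability, so the product is small as
    soon as [A] is. *)
Lemma cvg_mul_tight (A X : nat -> T -> R) mu :
  (forall n, measurable_fun setT (X n)) ->
  cvg_in_distribution P X mu ->
  A z.1 z.2 @[z --> nbhs_proba P] --> (0 : R) ->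
  A z.1 z.2 * X z.1 z.2 @[z --> nbhs_proba P] --> (0 : R).
Proof.
move=> mX Xmu A0; apply/cvgrPdist_lt => e e0 r r0.
have r2 : 0 < r / 2 by rewrite divr_gt0.
have [M PM] := cvg_in_distribution_tight mX Xmu r2.
pose M' := `|M| + 1.
have M0 : 0 < M' by rewrite ltr_wpDl.
move/cvgrPdist_lt : A0 => /(_ _ (divr_gt0 e0 M0))/(_ _ r2) A0.
apply: filterS2 PM A0 => n PM [B [mB PB AB]].
exists ([set w | M <= `|X n w|] `|` B); split.
- by apply: measurableU => //; exact: measurable_ge_norm.
- rewrite (le_trans (measureU2 _ _ _))//; first exact: measurable_ge_norm.
  by rewrite (splitr r) EFinD leeD.
move=> w /not_orP[/= /negP]; rewrite -ltNge => XM /AB /=.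
rewrite !sub0r !normrN normrM => Ae.
have XM' : `|X n w| <= M' by rewrite /M'; have := ler_norm M; lra.
rewrite (le_lt_trans (ler_wpM2l _ XM'))//.
by rewrite -ltr_pdivlMr.
Qed.

(** Uniform continuity by compactness, with [y] allowed to leave the segment: in Slutsky's theorem
    tightness confines only [X]. *)
Lemma continuous_near_segment (f : R -> R) (M e : R) : continuous f -> 0 < e ->
  \forall r \near 0^'+, forall x y, `|x| <= M -> `|x - y| < r ->
    `|f x - f y| < e.
Proof.
move=> fc e0.
have e2 : 0 < e / 2 by rewrite divr_gt0.
have /compact_near_coveringP cM := @segment_compact R (- M) M.
have : \forall r \near 0^'+, `[- M, M]%classic `<=`
    (fun x => forall y, `|x - y| < r -> `|f x - f y| < e).
  apply: (cM _ _ (fun r x => forall y, `|x - y| < r -> `|f x - f y| < e)) => x _.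
  have /cvgrPdist_lt/(_ _ e2) := fc x.
  rewrite -filter_from_ballE => -[r r0 rf] /=.
  have r2 : 0 < r / 2 by rewrite divr_gt0.
  exists (ball x (r / 2), [set s | s < r / 2]) => /=.
    split; first exact: nbhsx_ballx.
    exact: nbhs_right_lt.
  move=> [z s] /= [zx sr] y zy.
  rewrite /ball /= in zx.
  have fz : `|f x - f z| < e / 2 by apply: rf; rewrite /ball /=; lra.
  have fy : `|f x - f y| < e / 2.
    by apply: rf; rewrite /ball /=; have := ler_distD z x y; lra.
  by have := ler_distD (f x) (f z) (f y); rewrite (distrC (f z) (f x)); lra.
apply: filterS => r rf x y xM; apply: rf.
by rewrite /= in_itv/= -ler_norml.
Qed.

(** For a test function [f], the difference [f Y - f X] is bounded and tends to 0 in probability,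
    since [X] stays in a compact set up to small probability and [f] is uniformly continuous near
    it. Its expectation therefore tends to 0. *)
Lemma slutsky (X Y : nat -> T -> R) mu :
  (forall n, measurable_fun setT (X n)) ->
  (forall n, measurable_fun setT (Y n)) ->
  cvg_in_distribution P X mu ->
  Y z.1 z.2 - X z.1 z.2 @[z --> nbhs_proba P] --> (0 : R) ->
  cvg_in_distribution P Y mu.
Proof.
move=> mX mY Xmu YX f fc fb.
have [K fK] : exists K, forall x, `|f x| <= K.
  case: fb => K0 [_ fK0]; exists (K0 + 1) => x.
  by apply: (fK0 (K0 + 1)) => //; rewrite ltrDl.
have mf : measurable_fun setT f by exact: continuous_measurable_fun.
pose h n w := f (Y n w) - f (X n w).
have mfX n : measurable_fun setT (f \o X n) by exact: measurableT_comp.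
have mfY n : measurable_fun setT (f \o Y n) by exact: measurableT_comp.
have mh n : measurable_fun setT (h n).
  exact: (measurable_funB (mfY n) (mfX n)).
have hK n w : `|h n w| <= K + K.
  by rewrite (le_trans (ler_normB _ _))// lerD.
have h0 : (\int[P]_w (h n w)%:E)%E @[n --> \oo] --> 0%E.
  apply: (cvg_expectation_nbhs mh hK); apply/cvgrPdist_lt => e e0 r r0.
  have r2 : 0 < r / 2 by rewrite divr_gt0.
  have [M PM] := cvg_in_distribution_tight mX Xmu r2.
  have [/= s [s0 sf]] : exists s, 0 < s /\ forall x y, `|x| <= M ->
      `|x - y| < s -> `|f x - f y| < e.
    near (0 : R)^'+ => s; exists s; split=> //.
    near: s; exact: continuous_near_segment.
  move/cvgrPdist_lt : YX => /(_ _ s0)/(_ _ r2) YX.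
  apply: filterS2 PM YX => n PM [B [mB PB YXB]].
  exists ([set w | M <= `|X n w|] `|` B); split.
  - by apply: measurableU => //; exact: measurable_ge_norm.
  - rewrite (le_trans (measureU2 _ _ _))//; first exact: measurable_ge_norm.
    by rewrite (splitr r) EFinD leeD.
  move=> w /not_orP[/= /negP]; rewrite -ltNge => /ltW XM /YXB /=.
  rewrite sub0r opprB => /(sf _ _ XM).
  by rewrite sub0r /h opprB.
have -> : (fun n => 'E_P[f \o Y n])%E =
    (fun n => 'E_P[(f \o X n)%FUN] + \int[P]_w (h n w)%:E)%E.
  apply/funext => n; rewrite unlock -integralD_EFin//.
  - by apply: eq_integral => w _; rewrite /= -EFinD /h addrC subrK.
  - exact: (bounded_integrable P (mfX n) (fun w => fK (X n w))).
  - exact: (bounded_integrable P (mh n) (hK n)).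
rewrite -[X in _ --> X]adde0; apply: cvgeD => //.
  by rewrite fin_num_adde_defl.
exact: Xmu.
Unshelve. all: by end_near. Qed.

End weak_convergence.

(** * Integrals against normal laws and their scaling *)

Section normal_law.
Context (R : realType).
Local Notation mu := (@lebesgue_measure R).

Lemma normal_law0 (m : R) :
  normal_law m 0 = \d_(m : measurableTypeR R) :> probability (measurableTypeR R) R.
Proof. by rewrite /normal_law eqxx. Qed.

Lemma normal_lawE (m s : R) : s != 0 ->
  normal_law m s = normal_prob m s :> probability (measurableTypeR R) R.
Proof. by move=> s0; rewrite /normal_law ifN. Qed.

(** The Radon-Nikodym derivative of the normal law agrees almost everywhere with the Gaussian
    density, both having the same integral over every measurable set. *)
Lemma integral_normal_law (m s : R) (f : R -> \bar R) : s != 0 ->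
  (normal_law m s).-integrable setT f ->
  (\int[normal_law m s]_x f x = \int[mu]_x (f x * (normal_pdf m s x)%:E))%E.
Proof.
move=> s0; rewrite (normal_lawE m s0) => intf.
have dom := @normal_prob_dominates R m s.
have mf := measurable_int _ intf.
have mpdf : measurable_fun setT (EFin \o normal_pdf m s).
  by apply/measurable_EFinP; exact: measurable_normal_pdf.
rewrite -(Radon_Nikodym_change_of_variables dom)//=.
have iRN : mu.-integrable setT
    (Radon_Nikodym (charge_of_finite_measure (normal_prob m s)) mu).
  by apply: Radon_Nikodym_integrable; exact: dom.
apply: ae_eq_integral => //.
- apply: emeasurable_funM => //; exact: (measurable_int mu).
- exact: emeasurable_funM mf mpdf.
apply: ae_eqe_mul2l; apply: integral_ae_eq => //.
by move=> A _ mA; rewrite -Radon_Nikodym_integral.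
Qed.

Lemma normal_pdf_scale (s x : R) : 0 < s ->
  normal_pdf 0 s (s * x) * s = normal_pdf 0 1 x.
Proof.
move=> s0; rewrite !normal_pdfE ?gt_eqF ?oner_neq0//.
rewrite /normal_peak /normal_fun !subr0 mulrAC; congr (_ * expR _).
  rewrite -mulrnAr sqrtrM ?sqr_ge0// sqrtr_sqr gtr0_norm// expr1n mul1r.
  by rewrite invfM mulrAC mulVf ?gt_eqF// mul1r.
by rewrite exprMn expr1n; field; rewrite gt_eqF.
Qed.

(** Substitution [y = s x] against the Gaussian density. The formula used is for nonnegative
    integrands; the upper bound [K] gives integrability. *)
Lemma integral_normal_law_scale (s : R) (f : R -> R) (K : R) : 0 < s ->
  continuous f -> (forall x, 0 <= f x <= K) ->
  (\int[normal_law 0 1]_x (f (s * x))%:E =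
   \int[normal_law 0 s]_x (f x)%:E)%E.
Proof.
move=> s0 fc f0K.
have fK x : `|f x| <= K by have /andP[f0 ?] := f0K x; rewrite ger0_norm.
have mf : measurable_fun setT f by exact: continuous_measurable_fun.
have sc : continuous (fun x => s * x).
  by move=> x; apply: cvgM; [exact: cvg_cst|exact: cvg_id].
have mfs : measurable_fun setT (fun x => f (s * x)).
  apply: continuous_measurable_fun => x.
  by apply: (@continuous_comp _ _ _ (fun x => s * x) f); [exact: sc|exact: fc].
have s_neq0 : s != 0 by rewrite gt_eqF.
have Es := @integral_normal_law 0 s (EFin \o f) s_neq0
  (bounded_integrable (normal_law 0 s) mf fK).
have E1 := @integral_normal_law 0 1 (fun x => (f (s * x))%:E) (oner_neq0 R)
  (bounded_integrable (normal_law 0 1) mfs (fun x => fK (s * x))).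
rewrite [LHS]E1 [RHS]Es {Es E1}.
have d1 : ((fun x : R => s * x)^`())%classic = cst s.
  apply/funext => x; rewrite derive1E deriveM// derive_cst scaler0 addr0.
  by rewrite derive_id /GRing.scale /= mulr1.
under [RHS]eq_integral do rewrite -EFinM.
rewrite (@increasing_ge0_integration_by_substitutionT _ (fun x => s * x)
  (fun x => f x * normal_pdf 0 s x)).
- apply: eq_integral => x _; rewrite -EFinM d1 /= -mulrA.
  by rewrite -(normal_pdf_scale x s0).
- by move=> x y; rewrite ltr_pM2l.
- by rewrite d1 => x; exact: cvg_cst.
- by rewrite d1; exact: is_cvg_cst.
- by rewrite d1; exact: is_cvg_cst.
- by move=> x; exact: derivableM.
- exact/gt0_cvgMrNy.
- exact/gt0_cvgMry.
- move=> x; apply: cvgM; first exact: fc.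
  by apply: continuous_normal_pdf; rewrite gt_eqF.
- move=> x; rewrite mulr_ge0 ?normal_pdf_ge0//.
  by case/andP: (f0K x).
Qed.

Lemma cvg_in_distribution_scale d (T : measurableType d) (P : probability T R)
    (X : nat -> T -> R) (s : R) : 0 <= s ->
  cvg_in_distribution P X (normal_law 0 1) ->
  cvg_in_distribution P (fun n w => s * X n w) (normal_law 0 s).
Proof.
move=> s0 XN f fc fb.
have [K fK] : exists K, forall x, `|f x| <= K.
  case: fb => K0 [_ fK0]; exists (K0 + 1) => x.
  by apply: (fK0 (K0 + 1)) => //; rewrite ltrDl.
have mf : measurable_fun setT f by exact: continuous_measurable_fun.
have fsc : continuous (fun x => f (s * x)).
  move=> x; apply: (@continuous_comp _ _ _ (fun x => s * x) f); last exact: fc.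
  by apply: cvgM; [exact: cvg_cst|exact: cvg_id].
have mfs : measurable_fun setT (fun x => f (s * x)).
  exact: continuous_measurable_fun.
have int_cst (nu : probability (measurableTypeR R) R) (c : R) :
    (\int[nu]_x c%:E = c%:E)%E.
  by rewrite integral_cst//= probability_setT mule1.
have -> : (\int[normal_law 0 s]_x (f x)%:E =
    \int[normal_law 0 1]_x (f (s * x))%:E)%E.
  (* For [s = 0] the law is the point mass at 0, and both integrals equal [f 0]. *)
  have [->|sn0] := eqVneq s 0.
    rewrite normal_law0 integral_dirac//=; last exact/measurable_EFinP.
    rewrite diracT mul1e; under eq_integral do rewrite mul0r.
    exact/esym/(int_cst (normal_law 0 1)).
  have {sn0}s0 : 0 < s by rewrite lt_neqAle eq_sym sn0.
  (* Adding the bound [K] makes the test function nonnegative, as the substitution requires; the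
     constant cancels since both measures have mass 1. *)
  have shift (nu : probability (measurableTypeR R) R) (g : R -> R) :
      measurable_fun setT g -> (forall x, `|g x| <= K) ->
      (\int[nu]_x (g x)%:E = \int[nu]_x (g x + K)%:E - K%:E)%E.
    move=> mg gK; under [in RHS]eq_integral do rewrite EFinD.
    rewrite integralD//; last 2 first.
    - exact: (bounded_integrable nu mg gK).
    - exact: (@bounded_integrable _ _ _ nu (cst K) `|K|).
    by rewrite int_cst addeK.
  have Es := shift (normal_law 0 s) f mf fK.
  have E1 := shift (normal_law 0 1) _ mfs (fun x => fK (s * x)).
  rewrite [LHS]Es.
  rewrite [RHS]E1.
  congr (_ - _)%E; apply/esym.
  apply: (@integral_normal_law_scale s (fun x => f x + K) (K + K)) => //.
    by move=> x; apply: cvgD; [exact: fc|exact: cvg_cst].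
  by move=> x; have := fK x; rewrite ler_norml; lra.
apply: (XN (fun x => f (s * x)) fsc).
exists K; split; first exact: num_real.
by move=> M KM x _ /=; rewrite (le_trans (fK _))// ltW.
Qed.

End normal_law.

(** * Linearization of the estimating equation and conclusion *)

Lemma log_quotientE (R : realType) (l : R -> nat -> R) (theta t : R) (n : nat) :
  (1 < n)%N -> 0 < l t n -> 0 < l theta n ->
  (t - theta) * ln n%:R * (1 + log_quotient l theta t n) =
  ln (n%:R `^ t * l t n) - ln (n%:R `^ theta * l theta n).
Proof.
move=> n1 lt0 lth0; have n0 : 0 < n%:R :> R by rewrite ltr0n (ltn_trans _ n1).
rewrite !lnM ?posrE ?powR_gt0// !ln_powR /log_quotient.
have [->|tth] := eqVneq t theta; first by rewrite !subrr !mul0r.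
have lnn : ln n%:R != 0 :> R by rewrite gt_eqF// ln_gt0// ltr1n.
by field; rewrite lnn subr_eq0 tth.
Qed.

(** An exact identity: [v] and [Z] cancel on the right, leaving [H * sqrt m * ln (s / a)] minus
    [sigma * Z], with [a] the deterministic approximation of [m]. The grouping isolates three
    errors: in the coefficient of [Z], in the standardization, and in the approximation of the
    mean. *)
Lemma linearization (R : realType) (l : R -> nat -> R) (theta t : R) (n : nat)
    (m sigma v Z : R) :
  (1 < n)%N -> 0 < l t n -> 0 < l theta n -> 0 < m ->
  - 1 < log_quotient l theta t n ->
  let s := n%:R `^ t * l t n in
  let U := s / m in
  let H := Num.sqrt U / (1 + log_quotient l theta t n) in
  ln n%:R * Num.sqrt s * (t - theta) - sigma * Z =
  (H * ln_slope U * v - sigma) * Z +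
  H * ln_slope U * (Num.sqrt m * (U - 1) - v * Z) +
  H * (Num.sqrt m * ln (m / (n%:R `^ theta * l theta n))).
Proof.
move=> n1 lt0 lth0 m0 q1 s U H.
have n0 : 0 < n%:R :> R by rewrite ltr0n (ltn_trans _ n1).
have s0 : 0 < s by rewrite mulr_gt0// powR_gt0.
have a0 : 0 < n%:R `^ theta * l theta n by rewrite mulr_gt0// powR_gt0.
have U0 : 0 < U by rewrite divr_gt0.
have sE : s = U * m by rewrite /U divfK// gt_eqF.
have q0 : 1 + log_quotient l theta t n != 0 by rewrite gt_eqF//; lra.
have := log_quotientE n1 lt0 lth0; rewrite -/s ln_div ?posrE//.
rewrite [in ln s]sE lnM ?posrE// (ln_slopeE U) sE sqrtrM ?(ltW U0)//.
rewrite /H; move: (log_quotient _ _ _ _) q0 => q q0 E.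
have -> : ln n%:R * (Num.sqrt U * Num.sqrt m) * (t - theta) =
    Num.sqrt U * Num.sqrt m / (1 + q) * ((t - theta) * ln n%:R * (1 + q)).
  by field.
by rewrite E; field.
Qed.

(* The difference vanishes identically when VarS z.1 > 0; when VarS z.1 = 0 the
   second term is 0 because x / 0 = 0, and Chebyshev's inequality shows that the
   first one is 0 almost surely. *)
Lemma standardized_cvg_probability d (T : measurableType d) (R : realType)
    (P : probability T R) (S : nat -> {RV P >-> R}) :
  let ES n := fine ('E_P[S n])%E in
  let VarS n := fine ('V_P[S n])%E in
  (forall n, (0 < n)%N -> (S n : T -> R) \in Lfun P 2%:E) ->
  (\forall n \near \oo, 0 < ES n) ->
  Num.sqrt (ES z.1) * (S z.1 z.2 / ES z.1 - 1) -
    Num.sqrt (VarS z.1 / ES z.1) *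
    ((S z.1 z.2 - ES z.1) / Num.sqrt (VarS z.1))
  @[z --> nbhs_proba P] --> (0 : R).
Proof.
move=> ES VarS SL ES0; apply/cvgrPdist_lt => e e0 r r0; near=> n.
have m0 : 0 < ES n by near: n.
have n0 : (0 < n)%N by near: n; exact: nbhs_infty_gt.
have sm0 : 0 < Num.sqrt (ES n) by rewrite sqrtr_gt0.
have sm2 : Num.sqrt (ES n) ^+ 2 = ES n by rewrite sqr_sqrtr// ltW.
have D (x : R) : Num.sqrt (ES n) * (x / ES n - 1) = (x - ES n) / Num.sqrt (ES n).
  move: sm0 sm2; set t := Num.sqrt _ => t0 <-.
  by field; rewrite gt_eqF.
have : 0 <= VarS n by rewrite fine_ge0// variance_ge0.
rewrite le_eqVlt => /predU1P[V0|V0].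
  exists [set w | e * Num.sqrt (ES n) <= `|S n w - ES n|]; split.
  - exact: (measurable_ge_norm _ (measurable_funB _ _)).
  - rewrite (le_trans (chebyshev _ _))//; first by rewrite mulr_gt0.
    have -> : ('V_P[S n] = 0)%E.
      by rewrite -[LHS]fineK ?variance_fin_num ?SL//; congr _%:E; exact/esym.
    by rewrite mule0 lee_fin ltW.
  move=> w /= /negP; rewrite -ltNge -V0 mul0r sqrtr0 mul0r subr0 D sub0r normrN.
  by rewrite normrM (gtr0_norm (_ : 0 < (Num.sqrt _)^-1)) ?invr_gt0// ltr_pdivrMr.
exists set0; split => //; first by rewrite measure0 lee_fin ltW.
move=> w _ /=; rewrite D sqrtrM ?ltW// sqrtrV ?ltW//.
set v := Num.sqrt (VarS n).
have v0 : v != 0 by rewrite gt_eqF// sqrtr_gt0.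
rewrite [X in `|X|](_ : _ = 0) ?normr0//.
by field; rewrite v0 gt_eqF.
Unshelve. all: by end_near. Qed.

Theorem theorem1 (R : realType) (d : measure_display) (T : measurableType d)
    (P : probability T R) (theta sigma : R) (l : R -> nat -> R)
    (S theta_star : nat -> {RV P >-> R}) :
  0 < theta < 1 ->
  0 <= sigma ->
  (forall (t : R) (n : nat), 0 < t < 1 -> (0 < n)%N -> 0 < l t n) ->
  slowly_varying (l theta) ->
  (forall n : nat, (0 < n)%N -> (S n : T -> R) \in Lfun P 2%:E) ->
  let ES : nat -> R := fun n => fine ('E_P[S n])%E in
  let VarS : nat -> R := fun n => fine ('V_P[S n])%E in
  ES = (fun n => n%:R `^ theta * l theta n) +o_\oo (fun n => Num.sqrt (ES n)) ->
  VarS n / ES n @[n --> \oo] --> sigma ^+ 2 ->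
  {ae P, forall w, S n w / ES n @[n --> \oo] --> (1 : R)} ->
  cvg_in_distribution P
    (fun n w => (S n w - ES n) / Num.sqrt (VarS n)) (normal_law 0 1) ->
  (forall (n : nat) (w : T), (0 < n)%N ->
    0 < theta_star n w < 1 /\
    S n w = n%:R `^ theta_star n w * l (theta_star n w) n) ->
  cvg_in_probability P
    (fun n w => log_quotient l theta (theta_star n w) n) 0 ->
  cvg_in_distribution P
    (fun n w => ln n%:R * Num.sqrt (S n w) * (theta_star n w - theta))
    (normal_law 0 sigma).
Proof.
move=> theta01 sigma0 l0 svl SL ES VarS ESo VarES SES ZN eqS q0.
have /andP[th0 th1] := theta01.
have [c c0 ca] := slowly_varying_lower_bound th0
  (fun n => l0 theta n theta01) svl.
have [ES0 b0] := log_ratio_cvg0 c0 (filterS ca (nbhs_infty_gt 0)) ESo.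
pose Z n w := (S n w - ES n) / Num.sqrt (VarS n).
have mZ n : measurable_fun setT (Z n).
  by apply: measurable_funM => //; exact: measurable_funB.
pose q n w := log_quotient l theta (theta_star n w) n.
have mq n : measurable_fun setT (q n).
  have [->|n0] := posnP n.
    rewrite [q 0%N](_ : _ = cst 0)//; apply/funext => w.
    by rewrite /q /log_quotient [ln 0%:R]ln0// mulr0 invr0 mulr0.
  (* Measurability of [l] in its first argument is not assumed, so the estimating equation is used
     to express [ln l] at [theta_star] through [S n] and [theta_star]. *)
  have -> : q n = fun w => (ln (S n w) - theta_star n w * ln n%:R -
      ln (l theta n)) * ((theta_star n w - theta) * ln n%:R)^-1.
    apply/funext => w; have [t01 ->] := eqS n w n0.
    rewrite lnM ?posrE ?l0// ?powR_gt0 ?ltr0n// ln_powR.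
    by rewrite /q /log_quotient; congr (_ / _); ring.
  apply: measurable_funM.
    apply: measurable_funB => //; apply: measurable_funB.
      exact: (measurableT_comp (@measurable_ln R)).
    exact: measurable_funM.
  apply: measurable_inv_comp; apply: measurable_funM => //.
  exact: measurable_funB.
have qF : q z.1 z.2 @[z --> nbhs_proba P] --> (0 : R).
  exact: cvg_in_probability_nbhs.
have UF : S z.1 z.2 / ES z.1 @[z --> nbhs_proba P] --> (1 : R).
  apply: (@cvg_ae_nbhs _ _ _ _ (fun n w => S n w / ES n)) => // n.
  exact: measurable_funM.
have detF (u : nat -> R) (x : R) : u n @[n --> \oo] --> x ->
    u z.1 @[z --> nbhs_proba P] --> x.
  by move=> ux; apply: cvg_comp ux; exact: nbhs_proba_fst.
have vF : Num.sqrt (VarS z.1 / ES z.1) @[z --> nbhs_proba P] --> sigma.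
  apply: (detF (fun n => Num.sqrt (VarS n / ES n))).
  rewrite -(ger0_norm sigma0) -sqrtr_sqr.
  by apply: continuous_cvg VarES; exact: sqrt_continuous.
have bF := detF _ _ b0.
have DF := standardized_cvg_probability SL ES0.
pose H (z : nat * T) := Num.sqrt (S z.1 z.2 / ES z.1) / (1 + q z.1 z.2).
have HF : H z @[z --> nbhs_proba P] --> (1 : R).
  suff : H z @[z --> nbhs_proba P] --> (Num.sqrt 1 / (1 + 0) : R).
    by rewrite sqrtr1 addr0 divr1.
  apply: cvgM.
    by apply: continuous_cvg UF; exact: sqrt_continuous.
  apply: cvgV; first by rewrite addr0 oner_neq0.
  by apply: cvgD => //; exact: cvg_cst.
have HgF : H z * ln_slope (S z.1 z.2 / ES z.1) @[z --> nbhs_proba P] --> (1 : R).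
  rewrite -[X in _ --> X](mulr1 1); apply: cvgM => //.
  by apply: (cvg_comp _ _ UF); exact: cvg_ln_slope.
have mX n : measurable_fun setT (fun w => sigma * Z n w).
  exact: measurable_funM.
have mY n : measurable_fun setT
    (fun w => ln n%:R * Num.sqrt (S n w) * (theta_star n w - theta)).
  apply: measurable_funM; last exact: measurable_funB.
  apply: measurable_funM => //; exact: measurable_sqrt_comp.
(* The comparison variable is [sigma * Z], whose limit law is already the desired one. *)
apply: (slutsky mX mY (cvg_in_distribution_scale sigma0 ZN)).
pose G (z : nat * T) :=
  (H z * ln_slope (S z.1 z.2 / ES z.1) * Num.sqrt (VarS z.1 / ES z.1) - sigma) *
    Z z.1 z.2 +
  H z * ln_slope (S z.1 z.2 / ES z.1) *
    (Num.sqrt (ES z.1) * (S z.1 z.2 / ES z.1 - 1) -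
      Num.sqrt (VarS z.1 / ES z.1) * Z z.1 z.2) +
  H z * (Num.sqrt (ES z.1) * ln (ES z.1 / (z.1%:R `^ theta * l theta z.1))).
have GF : G z @[z --> nbhs_proba P] --> (0 : R).
  (* The first error vanishes by tightness of [Z], the second by [DF], the third by the
     deterministic limit [bF]. *)
  suff : G z @[z --> nbhs_proba P] --> (0 + 1 * 0 + 1 * 0 : R).
    by rewrite !mulr0 !addr0.
  apply: cvgD; first apply: cvgD.
  - apply: (cvg_mul_tight (A := fun n w => H (n, w) * ln_slope (S n w / ES n) *
      Num.sqrt (VarS n / ES n) - sigma) mZ ZN).
    rewrite -[X in _ --> X](subrr (1 * sigma)) {2}mul1r.
    by apply: cvgB; [exact: cvgM|exact: cvg_cst].
  - exact: cvgM.
  - exact: cvgM.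
apply: cvg_trans GF; apply: near_eq_cvg.
(* The identity holds only where [n > 1], the mean is positive and [q > -1], conditions that are
   eventual along the filter. *)
near=> z.
have n1 : (1 < z.1)%N.
  by near: z; exact: (@nbhs_proba_fst _ _ _ P _ (nbhs_infty_gt 1%N)).
have m0 : 0 < ES z.1 by near: z; exact: (@nbhs_proba_fst _ _ _ P _ ES0).
have qN1 : -1 < q z.1 z.2.
  by near: z; apply: (cvgr_gt 0 qF); rewrite ltrN10.
have n0 : (0 < z.1)%N by exact: ltn_trans n1.
have [t01 SE] := eqS z.1 z.2 n0.
have := linearization sigma (Num.sqrt (VarS z.1 / ES z.1)) (Z z.1 z.2) n1
  (l0 _ _ t01 n0) (l0 _ _ theta01 n0) m0 qN1.
by rewrite -SE => ->.
Unshelve. all: by end_near. Qed.
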